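(* Let $\mathcal{C}=(S,\Delta,r)$ be a semimatroid with $S\neq\emptyset$, with rank $r_{\mathcal{C}}$ and Tutte polynomial $T_{\mathcal{C}}(x,y)$. Then: (1) The rank function $r:\Delta\to\mathbb{N}$ is homology decidable, and $P(r;q,x)=(qx)^{r_{\mathcal{C}}}\,T_{\mathcal{C}}\!\left(\frac{qx+1}{qx},0\right)$. (2) The nullity function $n:\Delta\to\mathbb{N}$, $n(\sigma)=|\sigma|-r(\sigma)$, is monotone and homology decidable, and $P(n;q,x)=q^{r_{\mathcal{C}}}\,T_{\mathcal{C}}(0,qx+1)$. (3) $\Delta$ is semi-nonevasive, and $P(\Delta;q)=T_{\mathcal{C}}(0,0)\,q^{r_{\mathcal{C}}}$.
   Context: A semimatroid is a triple $(S,\Delta,r)$ with $S$ finite, $\Delta$ a non-void simplicial complex over $S$ (a family of subsets of $S$ closed under subsets), and $r:\Delta\to\mathbb{N}$ such that for all $\sigma,\tau\in\Delta$: (i) $0\le r(\sigma)\le|\sigma|$; (ii) $\sigma\subseteq\tau$ implies $r(\sigma)\le r(\tau)$; (iii) if $\sigma\cup\tau\in\Delta$ then $r(\sigma)+r(\tau)\ge r(\sigma\cup\tau)+r(\sigma\cap\tau)$; (iv) if $r(\sigma)=r(\sigma\cap\tau)$ then $\sigma\cup\tau\in\Delta$; (v) if $r(\sigma)<r(\tau)$ there is $y\in\tau\setminus\sigma$ with $\sigma\cup\{y\}\in\Delta$. A face $X$ is independent if $r(X)=|X|$; maximal independent faces (bases) all have the same size $r_{\mathcal{C}}$. The Tutte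 polynomial is $T_{\mathcal{C}}(x,y)=\sum_{\sigma\in\Delta}(x-1)^{r_{\mathcal{C}}-r(\sigma)}(y-1)^{|\sigma|-r(\sigma)}$. For a monotone $f:\Delta\to P$ ($P$ a poset), element decision trees, $p$-evasive faces, $ev_T(f,p,i)$, optimality and homology decidability are as follows. For $x\in S$, $\mathrm{del}_x(\Delta)=\{\tau\in\Delta:x\notin\tau\}$, $\mathrm{lk}_x(\Delta)=\{\tau\subseteq S\setminus\{x\}:\tau\cup\{x\}\in\Delta\}$ (over $S\setminus\{x\}$), $f_{\setminus x}=f|_{\mathrm{del}_x\Delta}$, $f_{/x}(\tau)=f(\tau\cup\{x\})$. An element decision tree is recursively: (1) a single leaf labeled $p$ when $\Delta=2^S$ and $f\equiv p$; (2) a root labeled $x$ with $\{x\}\notin\Delta$, whose ''$x\in\sigma$'' child is a leaf $N$ and whose ''$x\notin\sigma$'' child is a tree for $f_{\setminus x}$; (3) a root labeled $x$ with $\{x\}\in\Delta$, whose ''$x\in\sigma$'' child is a tree for $f_{/x}$ and whose ''$x\notin\sigma$'' child is a tree for $f_{\setminus x}$. $\sigma\in\Delta$ is $p$-evasive if $f(\sigma)=p$ and running the tree on $\sigma$ reaches a leaf at depth $|S|$; $ev_T(f,p,i)$ counts $p$-evasive faces of size $i$. With $\Delta_{\le p}=\{\sigma:f(\sigma)\le p\}$, $\Delta_{<p}=\{\sigma:f(\sigma)<p\}$ and $\widetilde\beta_j$ the relative reduced Betti numbers (augmented chain complexes, empty face in degree $-1$, over a fixed field), $T$ is optimal if $ev_T(f,p,i)=\widetilde\beta_{i-1}(\Delta_{\le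 p},\Delta_{<p})$ for all $p,i$, and $f$ is homology decidable if an optimal tree exists. $\Delta$ is semi-nonevasive if a constant function on $\Delta$ is homology decidable. For monotone $f:\Delta\to\mathbb{N}$, the Poincaré polynomial is $P(f;q,x)=\sum_{i\ge -1,\,j\ge 0}\widetilde\beta_i(\Delta_{\le j},\Delta_{<j})\,x^jq^{i+1}$, and $P(\Delta;q)=\sum_{i\ge -1}\widetilde\beta_i(\Delta)\,q^{i+1}$. *)

(* Defs.v *)
From HB Require Import structures.
From mathcomp Require Import all_boot all_order all_algebra.

Set Implicit Arguments.
Unset Strict Implicit.
Unset Printing Implicit Defensive.

Import Order.TTheory GRing.Theory.
Local Open Scope ring_scope.

(* Ground sets are subsets [S] of a fixed finite type [T], so that a deletion
   or a link over [S :\ x] lives in the same type.  A function on a complex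
   [D] is a function on all of [{set T}], of which only the values on the
   members of [D] are ever used. *)

Section SemimatroidDefs.

Variable T : finType.
Implicit Types (S A B : {set T}) (D : {set {set T}}) (r : {set T} -> nat).

Definition simplicial_complex S D : Prop :=
  (forall A, A \in D -> A \subset S) /\
  (forall A B, A \in D -> B \subset A -> B \in D).

Record semimatroid S D r : Prop := Semimatroid {
  sm_complex : simplicial_complex S D;
  sm_nonvoid : D != set0;
  sm_rank_card : forall A, A \in D -> (r A <= #|A|)%N;
  sm_rank_mono : forall A B, A \in D -> B \in D ->
    A \subset B -> (r A <= r B)%N;
  sm_rank_submod : forall A B, A \in D -> B \in D ->
    A :|: B \in D -> (r (A :|: B) + r (A :&: B) <= r A + r B)%N;
  sm_union : forall A B, A \in D -> B \in D ->
    r A = r (A :&: B) -> A :|: B \in D;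
  sm_augment : forall A B, A \in D -> B \in D ->
    (r A < r B)%N -> exists2 y, y \in B :\: A & y |: A \in D
}.

Definition indep D r : pred {set T} := [pred A in D | r A == #|A|].

Definition sm_basis D r : pred {set T} := [pred A | maxset (indep D r) A].

(* All bases have the same size (lemma [sm_basis_card] below), so the maximum
   is this common size. *)
Definition sm_rank D r : nat := (\max_(A | sm_basis D r A) #|A|)%N.

Lemma sm_basis_card S D r A :
  semimatroid S D r -> sm_basis D r A -> #|A| = sm_rank D r.
Proof.
move=> sm; have [[_ Dsub] _ rc rm rs _ ra] := sm.
have step X Y : X \in D -> Y \in D -> (r X < r Y)%N ->
    exists2 y, y \in Y :\: X & (y |: X \in D) && (r X < r (y |: X))%N.
  move=> XD YD ltXY.
  pose P (Z : {set T}) := [&& X \subset Z, Z \in D & r Z == r X].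
  have PX : P X by rewrite /P subxx XD eqxx.
  have [Z maxZ _] := maxset_exists PX.
  have [/and3P[sXZ ZD /eqP rZ] mZ] := maxsetP maxZ.
  have ltZY : (r Z < r Y)%N by rewrite rZ.
  have [y] := ra Z Y ZD YD ltZY.
  rewrite inE => /andP[yZ yY] yZD.
  have yXD : y |: X \in D by apply: Dsub yZD _; apply: setUS.
  have yX : y \notin X by apply: contra yZ; apply: (subsetP sXZ).
  exists y; first by rewrite inE yX.
  rewrite yXD /=.
  have ltZ : (r X < r (y |: Z))%N.
    rewrite ltn_neqAle rm ?(subset_trans sXZ) ?subsetUr // andbT.
    apply: contra yZ => /eqP rE.
    have <- : y |: Z = Z.
      apply: mZ; last exact: subsetUr.
      by rewrite /P yZD -rE eqxx (subset_trans sXZ) ?subsetUr.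
    by rewrite setU11.
  have := rs (y |: X) Z yXD ZD.
  have -> : (y |: X) :|: Z = y |: Z by rewrite -setUA (setUidPr sXZ).
  have -> : (y |: X) :&: Z = X.
    rewrite setIUl (setIidPl sXZ).
    suff -> : [set y] :&: Z = set0 by rewrite set0U.
    by apply/eqP; rewrite setI_eq0 disjoints1.
  move=> /(_ yZD); rewrite rZ leq_add2r => h.
  exact: leq_trans ltZ h.
have le X Y : sm_basis D r X -> sm_basis D r Y -> (#|Y| <= #|X|)%N.
  move=> /maxsetP[/andP[XD /eqP rX] mX] /maxsetP[/andP[YD /eqP rY] _].
  rewrite leqNgt; apply/negP; rewrite -rX -rY => lt.
  have [y] := step X Y XD YD lt.
  rewrite inE => /andP[yX _] /andP[yXD ltr].
  have E : y |: X = X.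
    apply: mX; last exact: subsetUr.
    rewrite /indep /= yXD eqn_leq rc //=.
    by rewrite cardsU1 yX -rX.
  by move/negP: yX; apply; rewrite -E setU11.
move=> bA; apply/eqP; rewrite eqn_leq; apply/andP; split.
  by rewrite /sm_rank (bigD1 A bA) leq_maxl.
by apply/bigmax_leqP => B bB; apply: le.
Qed.

(* T(x, y) with x = 'X and y = 'Y. *)
Definition tutte D r : {poly {poly int}} :=
  \sum_(A in D) ('X - 1) ^+ (sm_rank D r - r A) * ('Y - 1) ^+ (#|A| - r A).

Definition nullity r (A : {set T}) : nat := (#|A| - r A)%N.

End SemimatroidDefs.

Definition eval2 (R : comNzRingType) (p : {poly {poly int}}) (a b : R) : R :=
  (map_poly (map_poly (intr : int -> R)) p).[a, b].

Section RelativeHomology.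

Variables (F : fieldType) (T : finType).
Implicit Types (A : {set T}) (K L : {set {set T}}).

Definition chain := {ffun {set T} -> F^o}.

Definition face_chain A : chain := [ffun B => (B == A)%:R].

(* Faces are oriented by the enumeration order of [T]. *)
Definition bdry_face A : chain :=
  \sum_(x in A)
    (-1) ^+ #|[set y in A | (enum_rank y < enum_rank x)%N]|
      *: face_chain (A :\ x).

Definition bdry_fun (c : chain) : chain := \sum_A c A *: bdry_face A.

Fact bdry_fun_linear : linear bdry_fun.
Proof.
move=> a c d; rewrite /bdry_fun scaler_sumr -big_split /=.
by apply: eq_bigr => A _; rewrite !ffunE scalerDl scalerA.
Qed.

HB.instance Definition _ :=
  GRing.isLinear.Build F chain chain *:%R bdry_fun bdry_fun_linear.

Definition bdry : 'End(chain) := linfun bdry_fun.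

(* Chains supported on the faces of [K] with [k] vertices (degree k - 1). *)
Definition chains K k : {vspace chain} :=
  <<[seq face_chain A | A in [set A in K | #|A| == k]]>>%VS.

(* For k = 0 the value of [k.-1] is irrelevant: [bdry] kills [face_chain set0]. *)
Definition rel_cycles K L k : {vspace chain} :=
  (chains K k :&: (bdry @^-1: chains L k.-1))%VS.

Definition rel_boundaries K L k : {vspace chain} :=
  ((bdry @: chains K k.+1) + chains L k)%VS.

(* The reduced relative Betti number of the pair (K, L) in degree k - 1.  For
   complexes L included in K, the boundaries are contained in the cycles. *)
Definition rel_betti K L k : nat :=
  (\dim (rel_cycles K L k) - \dim (rel_boundaries K L k))%N.

Definition betti K k : nat := rel_betti K set0 k.

End RelativeHomology.

Section DecisionTrees.

Variables (T : finType) (d : Order.disp_t) (P : porderType d).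
Implicit Types (S A : {set T}) (D : {set {set T}}) (f : {set T} -> P) (x : T).

Definition del x D : {set {set T}} := [set A in D | x \notin A].
Definition lk x D : {set {set T}} :=
  [set A : {set T} | (x \notin A) && (x |: A \in D)].

Definition monotone_on D f : Prop :=
  forall A B, A \in D -> B \in D -> A \subset B -> (f A <= f B)%O.

Definition sublevel D f (p : P) : {set {set T}} := [set A in D | (f A <= p)%O].
Definition ssublevel D f (p : P) : {set {set T}} := [set A in D | (f A < p)%O].

(* [Query x t1 t0]: [t1] is the "x in A" child, [t0] the "x not in A" child. *)
Inductive dtree : Type :=
  | Leaf of P
  | NLeaf
  | Query of T & dtree & dtree.

Inductive element_dtree : {set T} -> {set {set T}} -> ({set T} -> P) ->
    dtree -> Prop :=
  | EdtLeaf S D f p :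
      D = powerset S -> (forall A, A \in D -> f A = p) ->
      element_dtree S D f (Leaf p)
  | EdtNonvertex S D f x t0 :
      x \in S -> [set x] \notin D ->
      element_dtree (S :\ x) (del x D) f t0 ->
      element_dtree S D f (Query x NLeaf t0)
  | EdtVertex S D f x t1 t0 :
      x \in S -> [set x] \in D ->
      element_dtree (S :\ x) (lk x D) (fun A => f (x |: A)) t1 ->
      element_dtree (S :\ x) (del x D) f t0 ->
      element_dtree S D f (Query x t1 t0).

(* The depth of the leaf reached by running [t] on [A]. *)
Fixpoint run_depth (t : dtree) A : nat :=
  if t is Query x t1 t0 then
    (if x \in A then run_depth t1 A else run_depth t0 A).+1
  else 0%N.

Definition evasive S D f t (p : P) A : bool :=
  [&& A \in D, f A == p & run_depth t A == #|S|].

Definition ev S D f t (p : P) (i : nat) : nat :=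
  #|[set A : {set T} | evasive S D f t p A & #|A| == i]|.

Definition optimal (F : fieldType) S D f t : Prop :=
  forall (p : P) (i : nat),
    ev S D f t p i = rel_betti F (sublevel D f p) (ssublevel D f p) i.

Definition homology_decidable (F : fieldType) S D f : Prop :=
  exists2 t, element_dtree S D f t & optimal F S D f t.

End DecisionTrees.

(* Neither the poset nor the constant value matters. *)
Definition semi_nonevasive (F : fieldType) (T : finType)
    (S : {set T}) (D : {set {set T}}) : Prop :=
  forall (d : Order.disp_t) (P : porderType d) (c : P),
    homology_decidable F S D (fun=> c).

(* P(f; q, x) with q = 'X and x = 'Y.  Beyond the summation bounds the pair of
   sublevel complexes has no relative faces of the given size. *)
Definition poincare2 (F : fieldType) (T : finType)
    (S : {set T}) (D : {set {set T}}) (f : {set T} -> nat) :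
    {poly {poly int}} :=
  \sum_(k < #|S|.+1) \sum_(j < (\max_(A in D) f A)%N.+1)
    (rel_betti F (sublevel D f j) (ssublevel D f j) k)%:R * 'Y ^+ j * 'X ^+ k.

Definition poincare1 (F : fieldType) (T : finType)
    (S : {set T}) (D : {set {set T}}) : {poly int} :=
  \sum_(k < #|S|.+1) (betti F D k)%:R * 'X ^+ k.

(* Main.v *)
(* A level set [Q] of a monotone function has relative Betti numbers
   [n_k - rho_k - rho_{k+1}], where [n_k] counts its faces with [k] elements and
   [rho_k] is the rank of the boundary map restricted to [Q].  Splitting [Q]
   along a query makes this map block triangular, so a decision tree bounds
   every [rho_k] from below by the number of pairs of nonevasive faces that it
   matches.  If all evasive faces at one level have the same size, these bounds
   are sharp: the tree is optimal and the Betti number is an Euler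
   characteristic, which the Tutte polynomial computes.

   For a semimatroid such trees come from deletion and contraction.  Loops do
   not change the rank, isthmuses do not change the nullity, and neither
   changes a constant function; an element that never changes the function is
   left for last and never asked, so that it makes all faces nonevasive.
   Otherwise any element is queried.  The evasive faces are then independent
   for the rank, spanning for the nullity, and both for a constant. *)

Require Import Defs.
From HB Require Import structures.
From mathcomp Require Import all_boot all_order all_algebra.
From mathcomp Require Import zify ring.

Set Implicit Arguments.
Unset Strict Implicit.
Unset Printing Implicit Defensive.

Import Order.TTheory GRing.Theory.
Local Open Scope ring_scope.

(** * Relative boundary ranks *)

Definition subset_closed (T : finType) (K : {set {set T}}) : Prop :=
  forall A B : {set T}, A \in K -> B \subset A -> B \in K.

Section RelativeRank.

Variables (F : fieldType) (T : finType).
Implicit Types (A B : {set T}) (K L Q : {set {set T}}) (c : chain F T).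

Local Notation face := (@face_chain F T).
Local Notation bdry := (bdry F T).

Definition slice Q k := [set A in Q | #|A| == k].

(** For [Q = K :\: L] this projection stands in for the quotient of the chains of [K] by those of
    [L], inside one ambient space. *)
Definition restrict_fun Q c : chain F T :=
  [ffun A => if A \in Q then c A else 0].

Fact restrict_fun_linear Q : linear (restrict_fun Q).
Proof.
move=> a c d; apply/ffunP => A; rewrite !ffunE.
by case: ifP => // _; rewrite scaler0 addr0.
Qed.

HB.instance Definition _ Q :=
  GRing.isLinear.Build F (chain F T) (chain F T) *:%R
    (restrict_fun Q) (restrict_fun_linear Q).

Definition restrict Q : 'End(chain F T) := linfun (restrict_fun Q).

Lemma restrictE Q c A : restrict Q c A = if A \in Q then c A else 0.
Proof. by rewrite lfunE /= ffunE. Qed.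

Lemma restrict_face Q A : restrict Q (face A) = if A \in Q then face A else 0.
Proof.
apply/ffunP => B; rewrite restrictE; case: ifP => BQ; case: ifP => AQ //.
  by rewrite !ffunE; case: eqP => // E; rewrite E AQ in BQ.
by rewrite !ffunE; case: eqP => // E; rewrite E AQ in BQ.
by rewrite ffunE.
Qed.

Lemma mem_restrict_ker Q c :
  reflect (forall A, A \in Q -> c A = 0) (c \in lker (restrict Q)).
Proof.
rewrite memv_ker; apply: (iffP eqP) => [E A AQ | E].
  by have := restrictE Q c A; rewrite AQ E ffunE.
by apply/ffunP => A; rewrite restrictE ffunE; case: ifP => // /E.
Qed.

Lemma chain_sum c : c = \sum_A c A *: face A.
Proof.
apply/ffunP => B; rewrite sum_ffunE (bigD1 B) //= big1 => [|A nAB].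
  by rewrite !ffunE eqxx addr0 /GRing.scale /= mulr1.
by rewrite !ffunE eq_sym (negbTE nAB) scaler0.
Qed.

Lemma memv_face K k A : A \in slice K k -> face A \in chains F K k.
Proof. by move=> AK; apply/memv_span/image_f. Qed.

Lemma mem_chains K k c :
  reflect (forall A, A \notin slice K k -> c A = 0) (c \in chains F K k).
Proof.
apply: (iffP idP) => [cK A AK | c0].
  have sub : (chains F K k <= lker (restrict (~: slice K k)))%VS.
    apply/span_subvP => _ /imageP[B BK ->].
    apply/mem_restrict_ker => C; rewrite inE ffunE => CK.
    by case: eqP => // E; rewrite E BK in CK.
  by move/mem_restrict_ker: (subvP sub _ cK); apply; rewrite inE.
rewrite (chain_sum c); apply: memv_suml => A _.
case: (boolP (A \in slice K k)) => [AK | /c0 ->]; last by rewrite scale0r mem0v.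
by apply/memvZ/memv_face.
Qed.

Lemma face_free (s : seq {set T}) : uniq s -> free (map face s).
Proof.
elim: s => [|A s IH] /=; first by rewrite nil_free.
case/andP => As us; rewrite free_cons IH // andbT.
apply/negP => fA.
have sub : (<<map face s>> <= lker (restrict [set A]))%VS.
  apply/span_subvP => _ /mapP[B Bs ->].
  apply/mem_restrict_ker => C; rewrite inE => /eqP ->.
  by rewrite ffunE; case: eqP => // E; rewrite E Bs in As.
have /mem_restrict_ker/(_ A) := subvP sub _ fA.
by rewrite inE eqxx ffunE eqxx => /(_ isT)/eqP; rewrite oner_eq0.
Qed.

Lemma dim_chains K k : \dim (chains F K k) = #|slice K k|.
Proof.
by rewrite (eqP (face_free (enum_uniq (slice K k)))) size_map -cardE.
Qed.

Lemma bdryE A : bdry (face A) = bdry_face F A.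
Proof.
rewrite lfunE /= /bdry_fun (bigD1 A) //= ffunE eqxx scale1r big1 ?addr0 //.
by move=> B nBA; rewrite ffunE (negbTE nBA) scale0r.
Qed.

(** * The boundary of a boundary *)

Definition below A (x : T) := #|[set y in A | (enum_rank y < enum_rank x)%N]|.

Lemma below_remove A x y : x \in A ->
  below A y = (below (A :\ x) y + (enum_rank x < enum_rank y))%N.
Proof.
move=> xA; rewrite /below (cardsD1 x) addnC !inE xA; congr (_ + _)%N.
by apply: eq_card => z; rewrite !inE andbA.
Qed.

Lemma bdry_bdry_face A : bdry (bdry_face F A) = 0.
Proof.
rewrite linear_sum /=.
under eq_bigr => x _ do rewrite linearZ /= bdryE /bdry_face scaler_sumr.
rewrite pair_big_dep /=.
(* Ordered pairs of removed vertices are split by [lt]; swapping components matches the two halves,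
   and matched terms cancel. *)
pose lt (p : T * T) := (enum_rank p.1 < enum_rank p.2)%N.
have swapK : involutive (fun p : T * T => (p.2, p.1)) by case.
rewrite (bigID lt) /= [X in _ + X](reindex_inj (inv_inj swapK)) /=.
rewrite [X in _ + X](eq_bigl
  (fun p => [&& p.1 \in A, p.2 \in A :\ p.1 & lt p])); last first.
  move=> [x y]; rewrite /lt /= !inE -leqNgt leq_eqVlt.
  rewrite [x == y]eq_sym; case: eqVneq => [->|nyx]; first by rewrite !andbF.
  have -> : (enum_rank x == enum_rank y :> nat) = false.
    apply/negbTE/eqP => /ord_inj/enum_rank_inj E.
    by rewrite E eqxx in nyx.
  by rewrite /= andbCA andbA.
rewrite [X in X + _](eq_bigl
  (fun p => [&& p.1 \in A, p.2 \in A :\ p.1 & lt p])); last first.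
  by move=> p; rewrite andbA.
rewrite -big_split /= big1 // => [[x y]] /= /and3P[xA].
rewrite !inE => /andP[nyx yA] ltxy.
have -> : A :\ y :\ x = A :\ x :\ y by rewrite setDDl setDDl setUC.
rewrite !scalerA -scalerDl.
rewrite /lt /= in ltxy.
(* Removing the earlier vertex [x] lowers the position of [y] by one, removing [y] leaves that of
   [x]: the signs are opposite. *)
rewrite -!/(below _ _) (below_remove y xA) (below_remove x yA) ltxy.
rewrite (ltnNge (enum_rank y)) ltnW //= addn0 addn1.
by rewrite exprS mulN1r mulNr [X in _ - X]mulrC subrr scale0r.
Qed.

Lemma bdryK c : bdry (bdry c) = 0.
Proof.
rewrite (chain_sum c) linear_sum linear_sum /= big1 // => A _.
by rewrite !linearZ /= bdryE bdry_bdry_face scaler0.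
Qed.

Lemma bdry_face_chains K k A : subset_closed K ->
  A \in slice K k -> bdry_face F A \in chains F K k.-1.
Proof.
move=> Kc; rewrite inE => /andP[AK /eqP sA].
apply: memv_suml => x xA; apply/memvZ/memv_face.
rewrite inE (Kc _ _ AK (subD1set A x)) /= -sA (cardsD1 x A) xA add1n.
exact: eqxx.
Qed.

Lemma limg_bdry_chains K k : subset_closed K ->
  (bdry @: chains F K k <= chains F K k.-1)%VS.
Proof.
move=> Kc; rewrite limg_span; apply/span_subvP => _ /mapP[_ /imageP[A AK ->] ->].
by rewrite bdryE; apply: bdry_face_chains.
Qed.

(** Refers to [Q] alone and not to a pair with difference [Q], so it applies to the parts into which
    a query splits [Q]. *)
Definition rel_rank Q k : nat :=
  \dim ((restrict Q \o bdry)%VF @: chains F Q k)%VS.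

Lemma rel_rank0 Q : rel_rank Q 0 = 0.
Proof.
apply/eqP; rewrite dimv_eq0 limg_span -subv0.
apply/span_subvP => _ /mapP[_ /imageP[A AK ->] ->].
move: AK; rewrite !inE cards_eq0 => /andP[_ /eqP ->].
by rewrite comp_lfunE bdryE /bdry_face big_set0 linear0 mem0v.
Qed.

(** * Relative Betti numbers in terms of boundary ranks *)

Section Pair.

Variables K L : {set {set T}}.
Hypotheses (Kc : subset_closed K) (Lc : subset_closed L) (LK : L \subset K).

Let Q := K :\: L.

Lemma chains_sub k : (chains F L k <= chains F K k)%VS.
Proof.
apply/span_subvP => _ /imageP[A AL ->]; apply: memv_face.
by move: AL; rewrite !inE => /andP[/(subsetP LK) -> ->].
Qed.

Lemma restrict_chains_sub k c : c \in chains F L k -> restrict Q c = 0.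
Proof.
move/mem_chains => c0; apply/eqP; rewrite -memv_ker.
by apply/mem_restrict_ker => A; rewrite !inE => /andP[AL _]; apply: c0;
  rewrite inE (negbTE AL).
Qed.

Lemma mem_chains_ker k c : c \in chains F K k -> restrict Q c = 0 ->
  c \in chains F L k.
Proof.
move=> /mem_chains cK cQ; apply/mem_chains => A.
rewrite inE => AL.
case: (boolP (A \in Q)) => AQ.
  by have := restrictE Q c A; rewrite AQ cQ ffunE.
apply: cK; rewrite inE; apply: contra AL => /andP[AK ->].
by move: AQ; rewrite inE AK andbT negbK => ->.
Qed.

(** The boundary of a face of [L] stays in [L] and dies under [restrict Q], so only faces in [Q]
    contribute. *)
Lemma dim_rel_image k :
  \dim ((restrict Q \o bdry)%VF @: chains F K k)%VS = rel_rank Q k.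
Proof.
congr (\dim _); apply/eqP; rewrite eqEsubv; apply/andP; split.
  rewrite limg_span; apply/span_subvP => _ /mapP[_ /imageP[A AK ->] ->].
  case: (boolP (A \in L)) => AL; last first.
    apply/memv_img/memv_face; move: AK; rewrite !inE => /andP[-> ->].
    by rewrite AL.
  rewrite comp_lfunE bdryE (@restrict_chains_sub k.-1) ?mem0v //.
  apply: bdry_face_chains => //.
  by move: AK; rewrite !inE AL => /andP[].
apply/limgS/span_subvP => _ /imageP[A AQ ->]; apply: memv_face.
by move: AQ; rewrite !inE -andbA => /and3P[_ -> ->].
Qed.

(** Rank-nullity for [restrict Q \o bdry] on the chains of [K]; its kernel there is the space of
    relative cycles. *)
Lemma dim_rel_cycles k :
  (\dim (rel_cycles F K L k) + rel_rank Q k = #|slice K k|)%N.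
Proof.
rewrite -dim_chains -dim_rel_image.
rewrite -(limg_ker_dim (restrict Q \o bdry)%VF (chains F K k)).
congr (\dim _ + _)%N; apply/vspaceP => c; rewrite !memv_cap.
case: (boolP (c \in chains F K k)) => //= cK.
rewrite -memv_preim memv_ker comp_lfunE; apply/idP/eqP.
  exact: restrict_chains_sub.
apply: mem_chains_ker.
exact: (subvP (limg_bdry_chains k Kc)) (memv_img _ cK).
Qed.

(** Rank-nullity for [restrict Q] on the relative boundaries; its kernel there is the space of
    chains of [L]. *)
Lemma dim_rel_boundaries k :
  \dim (rel_boundaries F K L k) = (#|slice L k| + rel_rank Q k.+1)%N.
Proof.
rewrite -dim_chains -dim_rel_image.
rewrite -(limg_ker_dim (restrict Q) (rel_boundaries F K L k)).
congr (_ + _)%N.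
  congr (\dim _); apply/vspaceP => c; rewrite memv_cap memv_ker; apply/andP/idP.
    case=> cB /eqP cQ; apply: mem_chains_ker cQ.
    apply: subvP cB; rewrite subv_add chains_sub andbT.
    exact: limg_bdry_chains.
  move=> cL; rewrite (restrict_chains_sub cL) eqxx; split=> //.
  by apply: subvP cL; apply: addvSr.
rewrite limgD limg_comp; congr (\dim _); apply/eqP; rewrite eqEsubv addvSl andbT.
rewrite subv_add subvv /=; apply/subvP => _ /memv_imgP[c cL ->].
by rewrite (restrict_chains_sub cL) mem0v.
Qed.

(** Makes the truncated subtraction in [rel_betti] a true difference. *)
Lemma rel_boundaries_sub k :
  (rel_boundaries F K L k <= rel_cycles F K L k)%VS.
Proof.
rewrite subv_add !subv_cap chains_sub limg_bdry_chains //=.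
apply/andP; split; apply/subvP => c cB; rewrite -memv_preim.
  by case/memv_imgP: cB => b _ ->; rewrite bdryK mem0v.
exact: (subvP (limg_bdry_chains k Lc)) (memv_img _ cB).
Qed.

Lemma rel_betti_rank k :
  (rel_betti F K L k + rel_rank Q k + rel_rank Q k.+1 = #|slice Q k|)%N.
Proof.
have card_slice : #|slice K k| = (#|slice Q k| + #|slice L k|)%N.
  rewrite addnC -(cardsID L (slice K k)); congr (_ + _)%N.
    apply: eq_card => A; rewrite !inE.
    case: (boolP (A \in L)) => [/(subsetP LK) -> | _]; last by rewrite andbF.
    by rewrite andbT.
  by apply: eq_card => A; rewrite !inE andbA.
have := dimvS (rel_boundaries_sub k).
have := dim_rel_cycles k; rewrite card_slice /rel_betti dim_rel_boundaries.
lia.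
Qed.

End Pair.

(** A face without [x] has no boundary face with [x]: the boundary matrix is block triangular, and
    its rank is at least the sum of the ranks of the diagonal blocks. *)
Lemma rel_rank_split Q x k :
  (rel_rank [set A in Q | x \notin A] k + rel_rank [set A in Q | x \in A] k
    <= rel_rank Q k)%N.
Proof.
set Q0 := [set A in Q | x \notin A]; set Q1 := [set A in Q | x \in A].
pose phi := (restrict Q \o bdry)%VF.
have no_x A : x \notin A -> restrict Q1 (bdry (face A)) = 0.
  move=> xA; rewrite bdryE linear_sum big1 //= => y yA.
  rewrite linearZ /= restrict_face !inE (negbTE xA) andbF andbF scaler0 //.
have restrict1 c : restrict Q1 (restrict Q c) = restrict Q1 c.
  apply/ffunP => A; rewrite !restrictE inE.
  by case: (A \in Q); case: (x \in A).
have sub0 : (chains F Q0 k <= chains F Q k)%VS.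
  apply/span_subvP => _ /imageP[A AQ ->]; apply: memv_face.
  by move: AQ; rewrite !inE -andbA => /and3P[-> _ ->].
have sub1 : (chains F Q1 k <= chains F Q k)%VS.
  apply/span_subvP => _ /imageP[A AQ ->]; apply: memv_face.
  by move: AQ; rewrite !inE -andbA => /and3P[-> _ ->].
rewrite /rel_rank -/phi.
(* In the image of [phi], the kernel of [restrict Q1] contains the image of the block without [x],
   and the projection contains that of the block with [x]. *)
rewrite -(limg_ker_dim (restrict Q1) (phi @: chains F Q k)%VS); apply: leq_add.
  apply: dimvS; rewrite limg_span; apply/span_subvP.
  move=> _ /mapP[_ /imageP[A AQ ->] ->].
  have xA : x \notin A by move: AQ; rewrite !inE => /andP[/andP[]].
  have -> : (restrict Q0 \o bdry)%VF (face A) = phi (face A).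
    rewrite !comp_lfunE; apply/ffunP => B; rewrite !restrictE inE.
    case: (B \in Q) => //=; case: (boolP (x \in B)) => //= xB.
    rewrite bdryE sum_ffunE big1 //= => y yA; rewrite !ffunE.
    case: eqP => [E|_]; last by rewrite scaler0.
    by move: xB; rewrite E !inE (negbTE xA) andbF.
  rewrite memv_cap memv_img; last exact/(subvP sub0)/memv_face.
  by rewrite memv_ker comp_lfunE restrict1 no_x // eqxx.
apply: dimvS; apply/subvP => _ /memv_imgP[c cQ ->].
rewrite comp_lfunE -restrict1 -(comp_lfunE (restrict Q) bdry).
by apply/memv_img/memv_img/(subvP sub1).
Qed.

(* If the members of [Q] without [x] can be completed by [x] within [Q], the
   boundary matrix between faces with and without [x] is diagonal with entries
   [1] and [-1]. *)
Lemma rel_rank_cone Q x k :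
  (forall A, A \in Q -> x |: A \in Q) ->
  (#|[set A in slice Q k | x \notin A]| <= rel_rank Q k.+1)%N.
Proof.
move=> cone; pose Q0 := [set A in Q | x \notin A].
have -> : #|[set A in slice Q k | x \notin A]| = \dim (chains F Q0 k).
  by rewrite dim_chains; apply: eq_card => A; rewrite !inE andbAC.
have key A : A \in slice Q0 k -> face A \in
    (restrict Q0 @: ((restrict Q \o bdry)%VF @: chains F Q k.+1))%VS.
  rewrite !inE -andbA => /and3P[AQ xA /eqP sA].
  (* The sign of [A] in the boundary of [x |: A], which squares to 1; the other boundary faces
     contain [x] and vanish under [restrict Q0]. *)
  pose s : F := (-1) ^+ below (x |: A) x.
  have -> : face A =
      restrict Q0 ((restrict Q \o bdry)%VF (s *: face (x |: A))).
    rewrite !linearZ /= comp_lfunE bdryE /bdry_face.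
    rewrite linear_sum linear_sum (bigD1 x) ?setU11 //=.
    rewrite setU1K // big1 ?addr0 => [|y /andP[yA nyx]]; last first.
      have -> : restrict Q0 (restrict Q
          ((-1) ^+ below (x |: A) y *: face ((x |: A) :\ y))) = 0.
        rewrite !linearZ /= !restrict_face.
        case: ifP => _; last by rewrite linear0 scaler0.
        by rewrite restrict_face !inE eqxx eq_sym nyx /= andbF scaler0.
      by [].
    rewrite !linearZ /= restrict_face AQ restrict_face inE AQ xA /=.
    by rewrite scalerA -expr2 sqrr_sign scale1r.
  apply/memv_img/memv_img/memvZ/memv_face.
  by rewrite inE cone //= cardsU1 xA sA.
apply: leq_trans (_ : \dim (restrict Q0 @: _)%VS <= _)%N.
  by apply: dimvS; apply/span_subvP => _ /imageP[A AQ ->]; apply: key AQ.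
by rewrite /rel_rank -[X in (_ <= X)%N](limg_ker_dim (restrict Q0)) leq_addl.
Qed.

End RelativeRank.

(** * Semimatroids and their decision trees *)

Section SemimatroidMinors.

Variable T : finType.
Implicit Types (S A B M : {set T}) (D : {set {set T}}) (r : {set T} -> nat).

Lemma simplicial_del S D x : simplicial_complex S D ->
  simplicial_complex (S :\ x) (del x D).
Proof.
move=> [DS Dsub]; split=> [A|A B]; rewrite !inE => /andP[AD xA].
  by rewrite subsetD1 xA DS.
by move=> BA; rewrite (Dsub _ _ AD BA); apply: contra xA; apply: subsetP.
Qed.

Lemma simplicial_lk S D x : simplicial_complex S D ->
  simplicial_complex (S :\ x) (lk x D).
Proof.
move=> [DS Dsub]; split=> [A|A B]; rewrite !inE => /andP[xA AD].
  by rewrite subsetD1 xA andbT; apply: subset_trans (DS _ AD); apply: subsetUr.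
move=> BA; rewrite (Dsub _ _ AD (setUS _ BA)) andbT.
by apply: contra xA; apply: subsetP.
Qed.

(** * Loops, isthmuses and spanning faces *)

Lemma sm_set0 S D r : semimatroid S D r -> set0 \in D.
Proof.
move=> sm; have [A AD] := set0Pn _ (sm_nonvoid sm).
by apply: (sm_complex sm).2 AD _; apply: sub0set.
Qed.

Lemma sm_rank_set0 S D r : semimatroid S D r -> r set0 = 0%N.
Proof.
by move=> sm; have := sm_rank_card sm (sm_set0 sm); rewrite cards0; case: (r _).
Qed.

Lemma sm_rank_add S D r x A : semimatroid S D r -> x |: A \in D ->
  (r (x |: A) <= r A + r [set x])%N.
Proof.
move=> sm xAD; have [_ Dsub] := sm_complex sm.
case: (boolP (x \in A)) => xA.
  by rewrite (setUidPr _) ?sub1set // leq_addr.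
have := sm_rank_submod sm (Dsub _ _ xAD (subsetUl _ _))
  (Dsub _ _ xAD (subsetUr _ _)) xAD.
have -> : [set x] :&: A = set0 by apply/eqP; rewrite setI_eq0 disjoints1.
by rewrite (sm_rank_set0 sm) addn0 addnC.
Qed.

(** A loop has the same rank as its intersection with [A], so the union axiom gives the face;
    subadditivity gives the rank. *)
Lemma sm_loop_apex S D r x A : semimatroid S D r -> [set x] \in D ->
  r [set x] = 0%N -> A \in D -> x |: A \in D /\ r (x |: A) = r A.
Proof.
move=> sm xD rx AD; have xAD : x |: A \in D.
  apply: sm_union AD _ => //; first exact: sm.
  case: (boolP (x \in A)) => xA; first by rewrite (setIidPl _) ?sub1set.
  have -> : [set x] :&: A = set0 by apply/eqP; rewrite setI_eq0 disjoints1.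
  by rewrite rx (sm_rank_set0 sm).
split=> //; apply/eqP.
rewrite eqn_leq (sm_rank_mono sm AD xAD (subsetUr _ _)) andbT.
by have := sm_rank_add sm xAD; rewrite rx addn0.
Qed.

(** An inclusion-maximal face above [A] works, since augmentation would enlarge one of smaller
    rank. *)
Lemma sm_spanning_face S D r A : semimatroid S D r -> A \in D ->
  exists M, [/\ M \in D, A \subset M & forall B, B \in D -> (r B <= r M)%N].
Proof.
move=> sm AD; have [M maxM AM] := @maxset_exists _ (mem D) A AD.
have [MD mM] := maxsetP maxM.
exists M; split=> // B BD; rewrite leqNgt; apply/negP => lt.
have [y] := sm_augment sm MD BD lt; rewrite inE => /andP[yM _] yMD.
by move: yM; rewrite -(mM _ yMD (subsetUr _ _)) setU11.
Qed.

(** Dropping the isthmus [x] from a spanning face [M] above [A] lowers the rank; submodularity of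
    [x |: A] and [M :\ x] carries this jump down to [A]. *)
Lemma sm_isthmus_apex S D r x A : semimatroid S D r ->
  (forall M, M \in D -> (forall B, B \in D -> (r B <= r M)%N) -> x \in M) ->
  A \in D -> x \notin A -> x |: A \in D /\ r (x |: A) = (r A).+1.
Proof.
move=> sm ist AD xA; have [_ Dsub] := sm_complex sm.
have [M [MD AM maxM]] := sm_spanning_face sm AD.
have xM := ist M MD maxM.
have xAD : x |: A \in D by apply: Dsub MD _; rewrite subUset sub1set xM.
have MxD : M :\ x \in D := Dsub _ _ MD (subD1set _ _).
have ltM : (r (M :\ x) < r M)%N.
  rewrite ltnNge; apply/negP => le.
  have /(ist _ MxD) : forall B, B \in D -> (r B <= r (M :\ x))%N.
    by move=> B /maxM lB; apply: leq_trans le.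
  by rewrite !inE eqxx.
have E : (x |: A) :|: (M :\ x) = M.
  apply/setP => y; rewrite !inE; case: eqVneq => [->|_] //=.
  by case: (boolP (y \in A)) => //= /(subsetP AM) ->.
have E' : (x |: A) :&: (M :\ x) = A.
  apply/setP => y; rewrite !inE; case: eqVneq => [->|_] /=.
    by rewrite (negbTE xA).
  by case: (boolP (y \in A)) => //= /(subsetP AM) ->.
have := sm_rank_submod sm xAD MxD; rewrite E E' => /(_ MD).
have xD : [set x] \in D := Dsub _ _ xAD (subsetUl _ _).
have := sm_rank_card sm xD; rewrite cards1.
have := sm_rank_add sm xAD.
by split=> //; lia.
Qed.

Lemma sm_rankE S D r : semimatroid S D r ->
  sm_rank D r = (\max_(A in D) r A)%N.
Proof.
move=> sm; have [_ Dsub] := sm_complex sm.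
apply/eqP; rewrite eqn_leq; apply/andP; split.
  apply/bigmax_leqP => B /maxsetP[/andP[BD /eqP <-] _].
  exact: (@leq_bigmax_cond _ (mem D)).
apply/bigmax_leqP => C CD.
have ind0 : indep D r set0.
  by rewrite /indep /= (sm_set0 sm) (sm_rank_set0 sm) cards0 /=.
have [B bB _] := maxset_exists ind0.
rewrite -(sm_basis_card sm bB).
have [/andP[BD /eqP rB] mB] := maxsetP bB.
have [M [MD BM maxM]] := sm_spanning_face sm BD.
apply: leq_trans (maxM _ CD) _.
(* No element of [M] raises the rank of the basis [B]. Submodularity extends this to a maximal [Z]
   of the same rank between [B] and [M], so [Z] is all of [M]. *)
pose P (Z : {set T}) := [&& B \subset Z, Z \subset M & r Z == r B].
have PB : P B by rewrite /P subxx BM eqxx.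
have [Z maxZ _] := maxset_exists PB.
have [/and3P[BZ ZM /eqP rZ] mZ] := maxsetP maxZ.
have ZD := Dsub _ _ MD ZM.
suff MZ : M \subset Z.
  by rewrite -rB -rZ; have /eqP <- : Z == M by rewrite eqEsubset ZM.
apply/subsetP => y yM; case: (boolP (y \in B)) => [/(subsetP BZ) //|yB].
have yBD : y |: B \in D by apply: Dsub MD _; rewrite subUset sub1set yM.
have yZM : y |: Z \subset M by rewrite subUset sub1set yM.
have yZD : y |: Z \in D := Dsub _ _ MD yZM.
have ryB : r (y |: B) = r B.
  apply/eqP; rewrite eqn_leq (sm_rank_mono sm BD yBD) ?subsetUr // andbT.
  rewrite leqNgt; apply/negP => lt.
  have /mB : indep D r (y |: B).
    rewrite /indep /= yBD eqn_leq (sm_rank_card sm) //= cardsU1 yB -rB.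
    by rewrite add1n.
  by move/(_ (subsetUr _ _)) => E; move: yB; rewrite -E setU11.
case: (boolP (y \in Z)) => // yZ.
have := sm_rank_submod sm yBD ZD.
have -> : (y |: B) :|: Z = y |: Z by rewrite -setUA (setUidPr BZ).
have -> : (y |: B) :&: Z = B.
  rewrite setIUl (setIidPl BZ).
  suff -> : [set y] :&: Z = set0 by rewrite set0U.
  by apply/eqP; rewrite setI_eq0 disjoints1.
move=> /(_ yZD); rewrite ryB rZ leq_add2r => le.
have /mZ : P (y |: Z).
  rewrite /P (subset_trans BZ) ?subsetUr // yZM eqn_leq le /= -rZ.
  exact: sm_rank_mono sm _ _ ZD yZD (subsetUr _ _).
by move/(_ (subsetUr _ _)) => E; move: yZ; rewrite -{1}E setU11.
Qed.

(** * Deletion and contraction *)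

Lemma semimatroid_del S D r x : semimatroid S D r ->
  semimatroid (S :\ x) (del x D) r.
Proof.
move=> sm; split.
- exact: simplicial_del (sm_complex sm).
- by apply/set0Pn; exists set0; rewrite !inE (sm_set0 sm).
- by move=> A; rewrite inE => /andP[AD _]; apply: sm_rank_card sm _ AD.
- move=> A B; rewrite !inE => /andP[AD _] /andP[BD _].
  exact: sm_rank_mono sm _ _ AD BD.
- move=> A B; rewrite !inE => /andP[AD _] /andP[BD _] /andP[UD _].
  exact: sm_rank_submod sm _ _ AD BD UD.
- move=> A B; rewrite !inE => /andP[AD xA] /andP[BD xB] E.
  by rewrite (sm_union sm AD BD E) (negbTE xA) (negbTE xB).
- move=> A B; rewrite !inE => /andP[AD xA] /andP[BD xB] lt.
  have [y yBA yAD] := sm_augment sm AD BD lt.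
  exists y => //; rewrite !inE yAD negb_or xA andbT.
  by apply: contra xB => /eqP ->; move: yBA; rewrite inE => /andP[].
Qed.

(** The truncated subtraction in the contracted rank loses nothing. *)
Lemma sm_rank_lk S D r x A : semimatroid S D r -> A \in lk x D ->
  r (x |: A) = (r (x |: A) - r [set x] + r [set x])%N.
Proof.
move=> sm; rewrite inE => /andP[_ xAD]; rewrite subnK //.
have [_ Dsub] := sm_complex sm.
by apply: sm_rank_mono sm _ _ _ _ _;
  rewrite ?subsetUl // (Dsub _ _ xAD) ?subsetUl.
Qed.

Lemma semimatroid_lk S D r x : semimatroid S D r -> [set x] \in D ->
  semimatroid (S :\ x) (lk x D) (fun A => r (x |: A) - r [set x])%N.
Proof.
move=> sm xD; have [_ Dsub] := sm_complex sm.
have lkP A : A \in lk x D -> x \notin A /\ x |: A \in D.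
  by rewrite inE => /andP.
split.
- exact: simplicial_lk (sm_complex sm).
- by apply/set0Pn; exists set0; rewrite !inE setU0 xD.
- move=> A /lkP[xA AD].
  have := sm_rank_add sm AD.
  by have := sm_rank_card sm (Dsub _ _ AD (subsetUr _ _)); lia.
- move=> A B /lkP[_ AD] /lkP[_ BD] AB; apply: leq_sub2r.
  by apply: (sm_rank_mono sm) => //; apply: setUS.
- move=> A B Al Bl Ul.
  have Il : A :&: B \in lk x D.
    move: Al Bl; rewrite !inE => /andP[xA AD] /andP[xB _]; rewrite (negbTE xA) /=.
    by apply: Dsub AD _; apply/setUS/subsetIl.
  have := sm_rank_submod sm (lkP _ Al).2 (lkP _ Bl).2.
  rewrite -setUUr -setUIr => /(_ (lkP _ Ul).2).
  have := sm_rank_lk sm Al; have := sm_rank_lk sm Bl.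
  by have := sm_rank_lk sm Il; have := sm_rank_lk sm Ul; lia.
- move=> A B Al Bl E; have [[xA AD] [xB BD]] := (lkP _ Al, lkP _ Bl).
  have Il : A :&: B \in lk x D.
    by rewrite !inE (negbTE xA) /=; apply: Dsub AD _; apply/setUS/subsetIl.
  rewrite !inE (negbTE xA) (negbTE xB) /= setUUr.
  apply: (sm_union sm) => //; rewrite -setUIr.
  by rewrite (sm_rank_lk sm Al) E -(sm_rank_lk sm Il).
- move=> A B Al Bl lt; have [[xA AD] [xB BD]] := (lkP _ Al, lkP _ Bl).
  have lt' : (r (x |: A) < r (x |: B))%N.
    by have := sm_rank_lk sm Al; have := sm_rank_lk sm Bl; lia.
  have [y] := sm_augment sm AD BD lt'.
  rewrite !inE negb_or => /andP[/andP[nyx yA]].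
  rewrite (negbTE nyx) /= => yB yAD; exists y; first by rewrite inE yA.
  by rewrite !inE negb_or eq_sym nyx xA /= setUCA.
Qed.

End SemimatroidMinors.

Section SemimatroidTrees.

Variables (T : finType) (d : Order.disp_t) (P : porderType d).
Implicit Types (S A B : {set T}) (D : {set {set T}}).

(** The complex is a cone over [x], and [f] does not see [x]. *)
Definition apex D (f : {set T} -> P) x :=
  [forall A in D, (x |: A \in D) && (f (x |: A) == f A)].

Lemma apex_del D f x y : x != y -> apex D f x -> apex (del y D) f x.
Proof.
move=> nxy /forall_inP ap; apply/forall_inP => A; rewrite !inE => /andP[AD yA].
by have /andP[-> ->] := ap A AD; rewrite negb_or [y == x]eq_sym nxy yA.
Qed.

Lemma apex_lk D f x y : x != y -> apex D f x ->
  apex (lk y D) (fun A => f (y |: A)) x.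
Proof.
move=> nxy /forall_inP ap; apply/forall_inP => A; rewrite !inE => /andP[yA AD].
by have := ap _ AD; rewrite negb_or [y == x]eq_sym nxy yA setUCA.
Qed.

(** A tree over [S] only asks about elements of [S]. *)
Lemma run_depth_agree S D f (t : dtree T P) A B : element_dtree S D f t ->
  A :&: S = B :&: S -> run_depth t A = run_depth t B.
Proof.
elim: t S D f => [p||x t1 IH1 t0 IH0] S D f //= et E.
have mono S' : S' \subset S -> A :&: S' = B :&: S'.
  by move=> /setIidPr <-; rewrite !setIA E.
inversion et as [| S' D' f' x' t' xS _ e0 | S' D' f' x' t1' t0' xS _ e1 e0];
  subst; have := congr1 (fun C : {set T} => x \in C) E;
  rewrite /= !inE xS !andbT => ->; case: ifP => // _; congr _.+1.
- by apply: IH0 e0 _; apply/mono/subD1set.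
- by apply: IH1 e1 _; apply/mono/subD1set.
- by apply: IH0 e0 _; apply/mono/subD1set.
Qed.

(* The apex is kept for the last query, which is then never asked. *)
Lemma apex_tree S D f x : simplicial_complex S D -> set0 \in D -> x \in S ->
  apex D f x ->
  exists2 t, element_dtree S D f t & forall A, (run_depth t A < #|S|)%N.
Proof.
elim: {S}#|S| {1 3 4 5}S (erefl #|S|) D f => [|n IH] S cS D f cD D0 xS ap.
  by move: xS; rewrite (cards0_eq cS) inE.
have cSx : #|S :\ x| = n by move: cS; rewrite (cardsD1 x) xS => -[].
(* With only [x] left, the complex is the full powerset and [f] is constant on it: a leaf at depth 0
   ends the tree one query early. *)
have [S0|] := set_0Vmem (S :\ x).
  have defS : S = [set x] by rewrite -(setD1K xS) S0 setU0.
  have /andP[xD /eqP fx] := forall_inP ap _ D0; rewrite setU0 in xD fx.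
  exists (Leaf T (f set0)) => //; apply: EdtLeaf.
    apply/setP => A; rewrite powersetE; apply/idP/idP; first exact: cD.1.
    rewrite defS subset1 => /orP[/eqP-> | /eqP->] //.
  move=> A /cD.1; rewrite defS subset1 => /orP[/eqP-> | /eqP->] //.
case=> y; rewrite !inE => /andP[nyx yS].
have nxy : x != y by rewrite eq_sym.
have cSy : #|S :\ y| = n by move: cS; rewrite (cardsD1 y) yS => -[].
(* Covers the leaf [NLeaf], which is reached at depth 1 and must stay above depth [n.+1]. *)
have n_gt0 : (0 < n)%N by rewrite -cSy (cardsD1 x) !inE nxy xS.
have [||||t0 e0 d0] := IH (S :\ y) cSy (del y D) f.
- exact: simplicial_del.
- by rewrite !inE D0.
- by rewrite !inE nxy.
- exact: apex_del.
case: (boolP ([set y] \in D)) => yD; last first.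
  exists (Query y (NLeaf T P) t0); first exact: EdtNonvertex.
  by move=> A /=; case: ifP => // _; rewrite ltnS.
have [||||t1 e1 d1] := IH (S :\ y) cSy (lk y D) (fun A => f (y |: A)).
- exact: simplicial_lk.
- by rewrite !inE setU0 yD.
- by rewrite !inE nxy.
- exact: apex_lk.
exists (Query y t1 t0); first exact: EdtVertex.
by move=> A /=; case: ifP => _; rewrite ltnS.
Qed.

(* For the rank function only [flat] holds, for the nullity only [slope], and
   for a constant function both: [flat] makes loops apexes, [slope] isthmuses. *)
Lemma semimatroid_tree (flat slope : bool) S D r (g : nat -> nat -> P)
    (f : {set T} -> P) :
  semimatroid S D r -> (forall A, A \in D -> f A = g (r A) #|A|) ->
  (flat -> forall a b, g a b.+1 = g a b) ->
  (slope -> forall a b, g a.+1 b.+1 = g a b) ->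
  exists2 t, element_dtree S D f t & forall A, A \in D ->
    run_depth t A = #|S| ->
    (flat -> r A = #|A|) /\ (slope -> forall B, B \in D -> (r B <= r A)%N).
Proof.
elim: {S}#|S| {1 3 4 5}S (erefl #|S|) D r g f
  => [|n IH] S cS D r g f sm fE gl gs.
  have S0 := cards0_eq cS.
  have D0 A : A \in D -> A = set0.
    by move/(sm_complex sm).1; rewrite S0 subset0 => /eqP.
  exists (Leaf T (f set0)) => [|A /D0-> _]; last first.
    rewrite (sm_rank_set0 sm) cards0; split=> // _ B /D0 ->.
    by rewrite (sm_rank_set0 sm).
  apply: EdtLeaf => [|A /D0 -> //]; apply/setP => A.
  rewrite powersetE S0 subset0; apply/idP/eqP => [/D0 // | ->].
  exact: sm_set0 sm.
(* An apex leaves no evasive face, so the claim on them is vacuous. *)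
case: (boolP [exists x in S, apex D f x]) => [/exists_inP[x xS ap]|].
  have [t et dt] := apex_tree (sm_complex sm) (sm_set0 sm) xS ap.
  by exists t => // A _ E; have := dt A; rewrite E cS ltnn.
move/exists_inPn => nap.
have [x xS] : exists x, x \in S by apply/set0Pn; rewrite -card_gt0 cS.
have cSx : #|S :\ x| = n by move: cS; rewrite (cardsD1 x) xS => -[].
have {nap} := nap x xS => nap.
have delE A : A \in del x D -> f A = g (r A) #|A|.
  by rewrite inE => /andP[/fE].
have [t0 e0 d0] := IH _ cSx _ _ g f (semimatroid_del x sm) delE gl gs.
(* If a face had larger rank than all faces avoiding [x], then [x] would be an isthmus, hence under
   [slope] an apex. *)
have noapex A B : slope -> B \in D ->
    (forall C, C \in del x D -> (r C <= r A)%N) -> (r B <= r A)%N.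
  move=> sl BD maxA; rewrite leqNgt; apply/negP => ltAB.
  case/negP: nap; apply/forall_inP => C CD.
  case: (boolP (x \in C)) => xC.
    by rewrite (setUidPr _) ?sub1set // CD eqxx.
  have [|xCD rC] := @sm_isthmus_apex _ S D r x C sm _ CD xC.
    move=> M MD maxM; apply: contraLR ltAB => xM.
    rewrite -leqNgt; apply: leq_trans (maxM _ BD) (maxA _ _).
    by rewrite inE MD.
  by rewrite xCD !fE // rC cardsU1 xC add1n gs // eqxx.
case: (boolP ([set x] \in D)) => xD; last first.
  have noX A : A \in D -> x \notin A.
    move=> AD; apply: contra xD => xA.
    by apply: (sm_complex sm).2 AD _; rewrite sub1set.
  exists (Query x (NLeaf T P) t0); first exact: EdtNonvertex.
  move=> A AD /=; rewrite (negbTE (noX A AD)) cS => -[dA].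
  have [|h1 h2] := d0 A _ (etrans dA (esym cSx)); first by rewrite inE AD noX.
  split=> // sl B BD; apply: h2 => //; by rewrite inE BD noX.
pose r' A := (r (x |: A) - r [set x])%N.
have sm' := semimatroid_lk sm xD.
have lkE A : A \in lk x D ->
    f (x |: A) = g (r' A + r [set x])%N #|A|.+1.
  move=> Al; rewrite -(sm_rank_lk sm Al); move: Al; rewrite inE => /andP[xA AD].
  by rewrite fE // cardsU1 xA.
(* In the link, ranks are shifted by [r [set x]] and sizes by one; the shifted [g] inherits both
   conditions. *)
have [||t1 e1 d1] := IH _ cSx _ _
  (fun a b => g (a + r [set x])%N b.+1) (fun A => f (x |: A)) sm' lkE.
- by move=> fl a b; apply: gl.
- by move=> sl a b; rewrite addSn gs.
exists (Query x t1 t0); first exact: EdtVertex.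
(* Under [flat] a loop would be an apex. *)
have rx : flat -> r [set x] = 1%N.
  move=> fl; have := sm_rank_card sm xD; rewrite cards1.
  case E: (r [set x]) => [|[|//]] // _; case/negP: nap.
  apply/forall_inP => A AD; have [xAD rA] := sm_loop_apex sm xD E AD.
  rewrite xAD !fE // rA cardsU1; case: (x \in A) => //=.
  by rewrite gl.
move=> A AD /=; rewrite cS; case: ifP => xA [] dA.
  have Al : A :\ x \in lk x D by rewrite !inE eqxx /= setD1K.
  have dAx : run_depth t1 (A :\ x) = #|S :\ x|.
    rewrite cSx -dA; apply: run_depth_agree e1 _.
    by apply/setP => y; rewrite !inE; case: (y == x); rewrite ?andbF.
  have [h1 h2] := d1 _ Al dAx; rewrite (setD1K xA) in h1 h2.
  have rA := sm_rank_lk sm Al; rewrite (setD1K xA) in rA.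
  split=> [fl|sl B BD].
    have := h1 fl; have := rx fl; have := cardsD1 x A.
    by rewrite xA; move: rA; clear; lia.
  (* A spanning face through the vertex [x] compares ranks in the link with ranks in [D]. *)
  have [M [MD xM maxM]] := sm_spanning_face sm xD.
  apply: leq_trans (maxM B BD) _.
  have xM' : x \in M by rewrite -sub1set.
  have Ml : M :\ x \in lk x D by rewrite !inE eqxx /= setD1K.
  have := h2 sl _ Ml; have := sm_rank_lk sm Ml; rewrite (setD1K xM').
  by move: rA; clear; lia.
have Ad : A \in del x D by rewrite inE AD xA.
have [h1 h2] := d0 A Ad (etrans dA (esym cSx)).
by split=> // sl B BD; apply: noapex => // C; apply: h2.
Qed.

End SemimatroidTrees.

(** * Homology of decision trees *)

Section TreeHomology.

Variables (F : fieldType) (T : finType) (d : Order.disp_t) (P : porderType d).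
Implicit Types (S A B R : {set T}) (D Q : {set {set T}}) (f : {set T} -> P).

Lemma card_slice_split Q x k (a : pred {set T}) :
  #|[set B in slice Q k | a B]| =
    (#|[set B in slice [set A in Q | x \notin A] k | a B]| +
     #|[set B in slice [set A in Q | x \in A] k | a B]|)%N.
Proof.
rewrite addnC -(cardsID [set B : {set T} | x \in B]); congr (_ + _)%N.
  apply: eq_card => B; rewrite !inE.
  by case: (B \in Q); case: (x \in B); rewrite ?andbF ?andbT.
apply: eq_card => B; rewrite !inE.
by case: (B \in Q); case: (x \in B); rewrite ?andbF ?andbT.
Qed.

Lemma card_slice_split1 Q x k :
  #|slice Q k| = (#|[set A in slice Q k | x \notin A]| +
                  #|[set A in slice Q k | x \in A]|)%N.
Proof.
rewrite addnC -(cardsID [set B : {set T} | x \in B]); congr (_ + _)%N.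
  by apply: eq_card => B; rewrite !inE.
by apply: eq_card => B; rewrite !inE andbC.
Qed.

(* Links are kept inside the original complex: [R] collects the elements
   already answered "yes", so a face [A] of the iterated link is represented by
   [R :|: A], and no sign enters when passing to a link. *)
Definition level (R : {set T}) D f p : {set {set T}} :=
  [set B : {set T} | [&& R \subset B, B :\: R \in D & f (B :\: R) == p]].

Lemma level_del R D f p x : x \notin R ->
  level R (del x D) f p = [set B in level R D f p | x \notin B].
Proof.
move=> xR; apply/setP => B; rewrite !inE xR /=.
by case: (R \subset B) => //=; case: (_ \in D) => //=; rewrite andbC.
Qed.

Lemma level_lk R D f p x : x \notin R ->
  level (x |: R) (lk x D) (fun A => f (x |: A)) p =
    [set B in level R D f p | x \in B].
Proof.
move=> xR; apply/setP => B; rewrite !inE subUset sub1set eqxx /=.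
case: (boolP (x \in B)) => xB; last by rewrite andbF.
have -> : x |: B :\: (x |: R) = B :\: R.
  by apply/setP => y; rewrite !inE; case: eqVneq => [->|_] //=; rewrite xR xB.
by rewrite andbT.
Qed.

(** The level is everything or empty, hence closed under adding and removing [x]; matching [A] with
    [x |: A] pairs off all its faces. *)
Lemma leaf_matching S R (q : P) f p x :
  (forall A, A \in powerset S -> f A = q) -> x \in S -> x \notin R ->
  exists m : nat -> nat, m 0%N = 0%N /\ forall k,
    (m k <= rel_rank F (level R (powerset S) f p) k)%N /\
    #|slice (level R (powerset S) f p) k| = (m k + m k.+1)%N.
Proof.
move=> fq xS xR; set Q := level _ _ _ _.
have addx A : A \in Q -> x |: A \in Q.
  rewrite !inE => /and3P[RA AS /eqP fA].
  have xAS : (x |: A) :\: R \in powerset S.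
    rewrite powersetE setDUl subUset AS andbT.
    by apply: subset_trans (subsetDl _ _) _; rewrite sub1set.
  rewrite -[_ :\: R \subset S]powersetE xAS (fq _ xAS).
  rewrite -(fq _ (etrans (powersetE _ _) AS)) fA.
  by rewrite eqxx (subset_trans RA) ?subsetUr.
have remx A : A \in Q -> A :\ x \in Q.
  rewrite !inE => /and3P[RA AS /eqP fA].
  have xAS : (A :\ x) :\: R \in powerset S.
    by rewrite powersetE (subset_trans _ AS) // setSD // subD1set.
  rewrite -[_ :\: R \subset S]powersetE xAS (fq _ xAS).
  rewrite -(fq _ (etrans (powersetE _ _) AS)) fA.
  by rewrite eqxx subsetD1 RA xR.
clearbody Q.
exists (fun k => if k is j.+1 then #|[set A in slice Q j | x \notin A]| else 0%N).
split=> // k; split; first by case: k => // k; apply: rel_rank_cone.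
rewrite (card_slice_split1 Q x) addnC; congr (_ + _)%N.
case: k => [|k].
  apply/eqP; rewrite cards_eq0; apply/eqP/setP => A; rewrite !inE cards_eq0.
  by case: (A =P set0) => [->|]; rewrite ?inE ?andbF.
rewrite -[RHS](@card_in_imset _ _ (fun A => x |: A)); last first.
  move=> A B; rewrite !inE => /andP[_ xA] /andP[_ xB] E.
  by rewrite -(setU1K xA) E setU1K.
apply: eq_card => B; apply/idP/imsetP.
  rewrite inE => /andP[]; rewrite inE => /andP[BQ /eqP sB] xB.
  exists (B :\ x); last by rewrite setD1K.
  rewrite inE setD11 andbT inE (remx _ BQ) /=.
  by move: sB; rewrite (cardsD1 x) xB add1n => -[->].
case=> A; rewrite !inE -andbA => /and3P[AQ /eqP sA xA] ->.
by rewrite addx //= cardsU1 xA sA add1n eqxx setU11.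
Qed.

(* The numbers [m k] count the pairs of nonevasive faces of sizes [k] and
   [k.-1] matched by the tree. *)
Lemma dtree_matching S D f t : element_dtree S D f t ->
  simplicial_complex S D -> forall R : {set T}, [disjoint R & S] -> forall p,
  exists m : nat -> nat, m 0%N = 0%N /\ forall k,
    (m k <= rel_rank F (level R D f p) k)%N /\
    #|slice (level R D f p) k| =
      (#|[set B in slice (level R D f p) k | run_depth t B == #|S|]|
        + m k + m k.+1)%N.
Proof.
elim=> {S D f t} [S D f q defD fq | S D f x t0 xS xD e0 IH
  | S D f x t1 t0 xS xD e1 IH1 e0 IH0] cD R dis p.
- rewrite defD in fq *.
  (* Over an empty ground set the leaf has full depth: all faces are evasive and none is matched. *)
  have [S0|[x xS]] := set_0Vmem S.
    exists (fun=> 0%N); split=> // k; split=> //; rewrite !addn0.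
    by apply: eq_card => B; rewrite [RHS]inE S0 cards0 eqxx andbT.
  have xR : x \notin R by rewrite (disjointFl dis).
  have [m [m0 mP]] := leaf_matching p fq xS xR.
  exists m; split=> // k; have [mk ->] := mP k; split=> //.
  have S_gt0 : (0 < #|S|)%N by rewrite card_gt0; apply/set0Pn; exists x.
  have -> : [set B in slice (level R (powerset S) f p) k |
      run_depth (Leaf T q) B == #|S|] = set0.
    by apply/setP => B; rewrite inE [RHS]inE /= (ltn_eqF S_gt0) andbF.
  by rewrite cards0.
- have xR : x \notin R by rewrite (disjointFl dis).
  have disx : [disjoint R & S :\ x] by apply: disjointWr dis; apply: subD1set.
  have [m [m0 mP]] := IH (simplicial_del x cD) R disx p.
  (* No face contains the nonvertex [x], so deletion changes nothing. *)
  have E : level R (del x D) f p = level R D f p.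
    rewrite level_del //; apply/setP => B; rewrite inE.
    case: (boolP (B \in _)) => //=; rewrite inE => /and3P[_ BD _].
    apply: contra xD => xB; apply: cD.2 BD _.
    by rewrite sub1set inE xR.
  exists m; split=> // k; have := mP k; rewrite E => -[mk ->]; split=> //.
  congr (_ + _ + _)%N; apply: eq_card => B; rewrite !inE.
  case: (boolP (R \subset B)) => //= RB.
  case: (boolP (B :\: R \in D)) => //= BD.
  have -> : (x \in B) = false.
    apply: contraNF xD => xB; apply: cD.2 BD _.
    by rewrite sub1set inE xR.
  by rewrite [#|S|](cardsD1 x) xS add1n eqSS.
- have xR : x \notin R by rewrite (disjointFl dis).
  have disx : [disjoint R & S :\ x] by apply: disjointWr dis; apply: subD1set.
  have disx1 : [disjoint (x |: R) & S :\ x].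
    rewrite disjoints_subset subUset sub1set !inE eqxx /=.
    by rewrite -disjoints_subset.
  have [m [m0 mP]] := IH0 (simplicial_del x cD) R disx p.
  have [n [n0 nP]] := IH1 (simplicial_lk x cD) (x |: R) disx1 p.
  (* The matchings of the two children are disjoint; [rel_rank_split] adds their rank bounds. *)
  exists (fun k => m k + n k)%N; split=> [|k]; first by rewrite m0 n0.
  have := mP k; rewrite level_del // => -[mk Em].
  have := nP k; rewrite level_lk // => -[nk En].
  split.
    by apply: leq_trans (rel_rank_split F (level R D f p) x k); apply: leq_add.
  rewrite (card_slice_split _ x) (card_slice_split1 _ x).
  have -> : [set A in slice (level R D f p) k | x \notin A]
      = slice [set A in level R D f p | x \notin A] k.
    by apply/setP => B; rewrite !inE andbAC.
  have -> : [set A in slice (level R D f p) k | x \in A]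
      = slice [set A in level R D f p | x \in A] k.
    by apply/setP => B; rewrite !inE andbAC.
  rewrite Em En.
  have -> : [set B in slice [set A in level R D f p | x \notin A] k |
      run_depth (Query x t1 t0) B == #|S|] =
    [set B in slice [set A in level R D f p | x \notin A] k |
      run_depth t0 B == #|S :\ x|].
    apply/setP => B; rewrite inE [RHS]inE.
    case: (boolP (B \in slice _ k)) => //=; rewrite inE => /andP[].
    rewrite inE => /andP[_ xB] _.
    by rewrite (negbTE xB) [#|S|](cardsD1 x) xS add1n eqSS.
  have -> : [set B in slice [set A in level R D f p | x \in A] k |
      run_depth (Query x t1 t0) B == #|S|] =
    [set B in slice [set A in level R D f p | x \in A] k |
      run_depth t1 B == #|S :\ x|].
    apply/setP => B; rewrite inE [RHS]inE.
    case: (boolP (B \in slice _ k)) => //=; rewrite inE => /andP[].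
    rewrite inE => /andP[_ xB] _.
    by rewrite xB [#|S|](cardsD1 x) xS add1n eqSS.
  lia.
Qed.

(** * Trees whose evasive faces at each level share one size *)

Section Concentrated.

Variables (S : {set T}) (D : {set {set T}}) (f : {set T} -> P) (t : dtree T P).
Variable dimp : P -> nat.
Hypotheses (cD : simplicial_complex S D) (f_mono : monotone_on D f).
Hypothesis tP : element_dtree S D f t.
Hypothesis evasive_size :
  forall A, A \in D -> run_depth t A = #|S| -> #|A| = dimp (f A).

Local Notation betti_at p k :=
  (rel_betti F (sublevel D f p) (ssublevel D f p) k).

Lemma levelE p : sublevel D f p :\: ssublevel D f p = level set0 D f p.
Proof.
apply/setP => A; rewrite !inE sub0set setD0 /=.
case: (A \in D) => //=; rewrite lt_neqAle.
by case: eqVneq => [->|_] /=; rewrite ?lexx // andNb.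
Qed.

Lemma betti_at_rank p k :
  (betti_at p k + rel_rank F (level set0 D f p) k
    + rel_rank F (level set0 D f p) k.+1 = #|slice (level set0 D f p) k|)%N.
Proof.
rewrite -levelE; apply: rel_betti_rank.
- move=> A B; rewrite !inE => /andP[AD fA] BA; have BD := cD.2 _ _ AD BA.
  by rewrite BD (le_trans (f_mono BD AD BA) fA).
- move=> A B; rewrite !inE => /andP[AD fA] BA; have BD := cD.2 _ _ AD BA.
  by rewrite BD (le_lt_trans (f_mono BD AD BA) fA).
by apply/subsetP => A; rewrite !inE => /andP[-> /ltW].
Qed.

Lemma evE p k : ev S D f t p k =
  #|[set B in slice (level set0 D f p) k | run_depth t B == #|S|]|.
Proof.
apply: eq_card => B; rewrite !inE sub0set setD0 /evasive /=.
by rewrite -!andbA; do 2!congr (_ && _); rewrite andbC.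
Qed.

Lemma ev_concentrated p k : k != dimp p -> ev S D f t p k = 0%N.
Proof.
move=> nk; apply/eqP; rewrite cards_eq0; apply/eqP/setP => A; rewrite !inE.
apply: contraNF nk => /andP[/and3P[AD /eqP <- /eqP dA] /eqP <-].
by rewrite (evasive_size AD dA).
Qed.

Lemma concentrated_optimal : optimal F S D f t.
Proof.
move=> p k.
have dis : [disjoint (set0 : {set T}) & S] by rewrite disjoints_subset sub0set.
have [m [m0 mP]] := dtree_matching tP cD dis p.
have key j : (m j <= rel_rank F (level set0 D f p) j)%N /\
   (betti_at p j + rel_rank F (level set0 D f p) j
     + rel_rank F (level set0 D f p) j.+1 = ev S D f t p j + m j + m j.+1)%N.
  by have [? E] := mP j; rewrite betti_at_rank evE.
(* Off [dimp p] nothing is evasive, so [m <= rel_rank] and the count in [key] force equality at [j]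
   and at [j.+1]. The index [dimp p] itself is reached from its predecessor, or is 0, where both
   sides vanish. *)
have rkE j : rel_rank F (level set0 D f p) j = m j.
  have [dj|dj] := eqVneq j (dimp p); last first.
    have := ev_concentrated dj; have [] := key j; have [] := key j.+1; lia.
  case: j dj => [|j] dj; first by rewrite rel_rank0 m0.
  have /ev_concentrated : j != dimp p by rewrite -dj; lia.
  have [] := key j; have [] := key j.+1; lia.
have [_] := key k; rewrite !rkE; lia.
Qed.

Lemma betti_concentrated p k : k != dimp p -> betti_at p k = 0%N.
Proof. by move=> nk; rewrite -concentrated_optimal ev_concentrated. Qed.

Lemma concentrated_poincare (K : comNzRingType) (z : K) p :
  \sum_(k < #|S|.+1) (betti_at p k)%:R * z ^+ k =
  \sum_(B in D | f B == p) (-1) ^+ (dimp p + #|B|) * z ^+ dimp p.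
Proof.
pose rk k := rel_rank F (level set0 D f p) k.
pose n k := #|slice (level set0 D f p) k|.
have level_sub B : B \in level set0 D f p -> B \subset S.
  by rewrite !inE setD0 => /and3P[_ /cD.1].
(* Truncated Euler-Poincaré formula; the last boundary rank is the error term. *)
have telescope N : \sum_(k < N) (-1) ^+ k * (n k)%:R =
    \sum_(k < N) (-1) ^+ k * (betti_at p k)%:R - (-1) ^+ N * (rk N)%:R :> K.
  elim: N => [|N IH]; first by rewrite !big_ord0 /rk rel_rank0 mulr0 subr0.
  rewrite !big_ord_recr /= IH /n -betti_at_rank -/(rk N) -/(rk N.+1) !natrD.
  by rewrite exprS; ring.
have rk_end : rk #|S|.+1 = 0%N.
  have : n #|S|.+1 = 0%N.
    apply/eqP; rewrite cards_eq0; apply/eqP/setP => B; rewrite inE [RHS]inE.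
    apply: contraTF (@leqnn #|S|) => /andP[/level_sub/subset_leq_card le /eqP E].
    by rewrite E ltnn in le.
  by rewrite /n -betti_at_rank -/(rk _); lia.
have euler : \sum_(B in D | f B == p) (-1) ^+ #|B| =
    \sum_(k < #|S|.+1) (-1) ^+ k * (betti_at p k)%:R :> K.
  have := telescope #|S|.+1; rewrite rk_end mulr0 subr0 => <-.
  rewrite (eq_bigl (fun B => B \in level set0 D f p)); last first.
    by move=> B; rewrite !inE sub0set setD0.
  rewrite (partition_big (fun B => inord #|B| : 'I_#|S|.+1) predT) //=.
  apply: eq_bigr => k _.
  rewrite (eq_bigr (fun=> (-1) ^+ k)); last first.
    move=> B /andP[/level_sub/subset_leq_card le /eqP <-].
    by rewrite inordK.
  rewrite sumr_const -[LHS]mulr_natr; congr (_ * _%:R).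
  apply: eq_card => B; rewrite [in RHS]inE -topredE /=.
  case: (boolP (B \in _)) => //= /level_sub/subset_leq_card le.
  by rewrite -val_eqE /= inordK.
(* Only [k = dimp p] carries homology, so the sum is an Euler characteristic up to the sign and
   power at [dimp p]. *)
rewrite (eq_bigr (fun k : 'I__ => (-1) ^+ dimp p * z ^+ dimp p *
    ((-1) ^+ k * (betti_at p k)%:R))); last first.
  move=> k _; have [->|/betti_concentrated ->] := eqVneq (k : nat) (dimp p).
    have := sqrr_sign K (dimp p); rewrite expr2 => E.
    by rewrite mulrACA mulrA E mul1r mulrC.
  by rewrite mul0r !mulr0.
rewrite -big_distrr /= -euler big_distrr /=; apply: eq_bigr => B _.
by rewrite exprD mulrAC.
Qed.

End Concentrated.

End TreeHomology.

(** * Evaluations of the Tutte polynomial *)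

Section TutteEvaluation.

Variable T : finType.
Implicit Types (A B S : {set T}) (D : {set {set T}}) (r : {set T} -> nat).

Lemma eval2_tutte (R : comNzRingType) D r (a b : R) :
  eval2 (tutte D r) a b =
    \sum_(A in D) (a - 1) ^+ (sm_rank D r - r A) * (b - 1) ^+ (#|A| - r A).
Proof.
rewrite /eval2 /tutte rmorph_sum /= !horner_sum; apply: eq_bigr => A _.
rewrite rmorphM !rmorphXn !rmorphB /= !rmorph1 map_polyC /=.
by rewrite !map_polyX !hornerE.
Qed.

Lemma signr_shift (R : pzRingType) a b c :
  a = (b + c * 2)%N -> (-1) ^+ a = (-1) ^+ b :> R.
Proof. by move=> ->; rewrite exprD exprM sqrr_sign mulr1. Qed.

(** By submodularity, adding [B :\: A] raises the rank by at most [#|B :\: A|]. *)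
Lemma nullity_mono S D r : semimatroid S D r -> monotone_on D (nullity r).
Proof.
move=> sm A B AD BD AB; rewrite leEnat /nullity.
have BAD : B :\: A \in D := (sm_complex sm).2 _ _ BD (subsetDl _ _).
have E : A :|: (B :\: A) = B by rewrite -{1}(setIidPr AB) setID.
have E' : A :&: (B :\: A) = set0.
  by apply/setP => y; rewrite !inE; case: (y \in A).
have := sm_rank_submod sm AD BAD; rewrite E E' => /(_ BD).
have := sm_rank_card sm BAD; have := sm_rank_card sm AD.
by have := cardsID A B; rewrite (setIidPr AB); lia.
Qed.

Lemma sm_rank_max S D r A : semimatroid S D r -> A \in D ->
  (forall B, B \in D -> (r B <= r A)%N) -> r A = sm_rank D r.
Proof.
move=> sm AD maxA; rewrite (sm_rankE sm); apply/eqP; rewrite eqn_leq.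
rewrite (@leq_bigmax_cond _ (mem D)) //=.
by apply/bigmax_leqP => B; apply: maxA.
Qed.

Lemma sm_rank_ge S D r A : semimatroid S D r -> A \in D ->
  (r A <= sm_rank D r)%N.
Proof. by move=> sm AD; rewrite (sm_rankE sm) (@leq_bigmax_cond _ (mem D)). Qed.

(** Each level contributes its Euler characteristic; regrouping the levels leaves one signed
    monomial per face, ready for comparison with the Tutte sum. *)
Lemma poincare2_concentrated (F : fieldType) S D (f : {set T} -> nat) t
    (dimp : nat -> nat) :
  simplicial_complex S D -> monotone_on D f -> element_dtree S D f t ->
  (forall A, A \in D -> run_depth t A = #|S| -> #|A| = dimp (f A)) ->
  poincare2 F S D f =
    \sum_(A in D) (-1) ^+ (dimp (f A) + #|A|) * ('Y ^+ f A * 'X ^+ dimp (f A)).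
Proof.
move=> cD fm et size_ev; rewrite /poincare2 exchange_big /=.
rewrite [RHS](partition_big
  (fun A => inord (f A) : 'I_(\max_(A in D) f A)%N.+1) predT) //=.
apply: eq_bigr => j _.
under eq_bigr => k _ do rewrite mulrAC mulrC.
rewrite -big_distrr /= (concentrated_poincare F cD fm et size_ev) big_distrr /=.
apply: eq_big => [A|A /andP[AD /eqP ->]]; last by rewrite mulrCA.
case: (boolP (A \in D)) => //= AD.
by rewrite -val_eqE /= inordK // ltnS (@leq_bigmax_cond _ (mem D)).
Qed.

End TutteEvaluation.

Theorem theorem3p5 (F : fieldType) (T : finType) (S : {set T})
    (D : {set {set T}}) (r : {set T} -> nat)
    (sm : semimatroid S D r) (S_neq0 : S != set0) :
  let rC := sm_rank D r in
  let q : {poly {poly int}} := 'X in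
  let x : {poly {poly int}} := 'Y in
  let frac : {poly {poly int}} -> {fraction {poly {poly int}}} :=
    @FracField.tofrac _ in
  [/\ homology_decidable F S D r /\
      frac (poincare2 F S D r) =
        frac (q * x) ^+ rC * eval2 (tutte D r) (frac (q * x + 1) / frac (q * x)) 0,
      [/\ monotone_on D (nullity r),
          homology_decidable F S D (nullity r) &
          poincare2 F S D (nullity r) =
            q ^+ rC * eval2 (tutte D r) 0 (q * x + 1)]
    & semi_nonevasive F S D /\
      poincare1 F S D = (eval2 (tutte D r) (0 : int) 0)%:P * 'X ^+ rC].
Proof.
move=> rC q x frac; have cD := sm_complex sm.
have rA_card A : A \in D -> (r A <= #|A|)%N := sm_rank_card sm (A := A).
have rA_rC A : A \in D -> (r A <= rC)%N := sm_rank_ge sm (A := A).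
split.
- have r_mono : monotone_on D r by move=> A B; apply: (sm_rank_mono sm).
  have [|//||t et dt] := @semimatroid_tree T _ nat true false S D r
    (fun a _ => a) r sm.
  + by [].
  + by [].
  (* Evasive faces are independent, so their size is their rank. *)
  have size_ev A : A \in D -> run_depth t A = #|S| -> #|A| = id (r A).
    by move=> AD dA; have [-> //] := dt A AD dA.
  split.
    by exists t => //; apply: (@concentrated_optimal F T _ nat S D r t id).
  have PE := @poincare2_concentrated T F S D r t id cD r_mono et size_ev.
  rewrite PE eval2_tutte.
  have qx0 : frac (q * x) != 0.
    by rewrite /frac tofrac_eq0 /q /x mulf_neq0 // ?polyC_eq0 polyX_eq0.
  have -> : frac (q * x + 1) / frac (q * x) - 1 = (frac (q * x))^-1.
    by rewrite /frac rmorphD rmorph1 mulrDl divff // mul1r addrAC subrr add0r.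
  have monomE a b : frac ((-1) ^+ a * (x ^+ b * q ^+ b)) =
      (-1) ^+ a * frac (q * x) ^+ b.
    by rewrite -exprMn [x * q]mulrC /frac rmorphM !rmorphXn rmorphN rmorph1.
  rewrite /frac rmorph_sum big_distrr -/frac /=; apply: eq_bigr => A AD.
  rewrite -/frac monomE sub0r exprVn mulrA -/rC.
  rewrite (@signr_shift _ _ (#|A| - r A) (r A)); last first.
    by have := rA_card A AD; lia.
  rewrite mulrC; congr (_ * _).
  (* The factor [(q * x) ^+ rC] clears the denominator and leaves exponent [r A]. *)
  rewrite (_ : rC = (rC - r A) + r A)%N; last by rewrite subnK ?rA_rC.
  by rewrite exprD addnK mulrAC mulfV ?expf_neq0 // mul1r.
- have n_mono := nullity_mono sm.
  have [//|//||t et dt] := @semimatroid_tree T _ nat false true S D r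
    (fun a b => b - a)%N (nullity r) sm.
  + by move=> _ a b; rewrite subSS.
  (* Evasive faces are spanning, so their size is their nullity plus [rC]. *)
  have size_ev A : A \in D -> run_depth t A = #|S| ->
      #|A| = (nullity r A + rC)%N.
    move=> AD dA; have [_ /(_ isT) maxA] := dt A AD dA.
    by rewrite /rC -(sm_rank_max sm AD maxA) /nullity subnK ?rA_card.
  have := @concentrated_optimal F T _ nat S D (nullity r) t (addn^~ rC).
  move=> /(_ cD n_mono et size_ev) opt.
  split=> //; first by exists t.
  have PE := @poincare2_concentrated T F S D _ t (addn^~ rC) cD n_mono et size_ev.
  rewrite PE eval2_tutte big_distrr /=; apply: eq_bigr => A AD.
  rewrite addrK sub0r -/rC -/(nullity r A) exprMn.
  rewrite (@signr_shift _ _ (rC - r A) #|A|); last first.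
    by have := rA_card A AD; have := rA_rC A AD; rewrite /nullity; lia.
  rewrite exprD [RHS]mulrCA; congr (_ * _).
  by rewrite mulrA mulrC; congr (_ * _); rewrite mulrC.
have const_tree (d : Order.disp_t) (P : porderType d) (c : P) : exists2 t,
    element_dtree S D (fun=> c) t &
    forall A, A \in D -> run_depth t A = #|S| -> #|A| = rC.
  (* With both conditions in force, evasive faces are independent and spanning, of size [rC]. *)
  have [//|//|//|t et dt] := @semimatroid_tree T d P true true S D r
    (fun _ _ => c) (fun=> c) sm.
  exists t => // A AD dA; have [/(_ isT) <- /(_ isT) maxA] := dt A AD dA.
  exact: sm_rank_max sm AD maxA.
have const_mono (d : Order.disp_t) (P : porderType d) (c : P) :
  monotone_on D (fun=> c) by move=> A B _ _ _; apply: lexx.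
split.
  move=> d P c; have [t et size_ev] := const_tree d P c; exists t => //.
  exact: (@concentrated_optimal F T d P S D _ t (fun=> rC)).
(* For the constant 0, level 0 is the pair of [D] and the empty family, which gives the absolute
   Betti numbers. *)
have [t et size_ev] := const_tree _ nat 0%N.
have := @concentrated_poincare F T _ nat S D (fun=> 0%N) t (fun=> rC) cD
  (const_mono _ nat 0%N) et size_ev {poly int} 'X 0%N.
have -> : sublevel D (fun=> 0%N) 0%N = D.
  by apply/setP => A; rewrite inE lexx andbT.
have -> : ssublevel D (fun=> 0%N) 0%N = set0.
  by apply/setP => A; rewrite !inE ltxx andbF.
rewrite /poincare1 /betti => ->; rewrite eval2_tutte rmorph_sum big_distrl /=.
under eq_bigl => A do rewrite eqxx andbT.
apply: eq_bigr => A AD; rewrite sub0r -exprD rmorphXn rmorphN rmorph1 /=.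
congr (_ * _); apply: (@signr_shift _ _ _ (r A)).
by have := rA_card A AD; have := rA_rC A AD; lia.
Qed.
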